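(* Let $n\ge1$, let $H\in\mathbb{R}^{n\times n}$ be symmetric positive definite, $\delta>0$, $b\in\mathbb{R}^n\setminus\{0\}$, $\beta=\sqrt{b^{\mathsf T}H^{-1}b}>0$, and $\widehat b=H^{-1/2}b$, so $\|\widehat b\|=\beta$. For $a>\beta$ let $$F_a(y)=a\sqrt{\delta^2+\|y\|^2}+\widehat b^{\mathsf T}y\quad(y\in\mathbb{R}^n),\qquad \Delta=\sqrt{a^2-\beta^2},\qquad y_a^*=-\frac{\delta\,\widehat b}{\sqrt{a^2-\beta^2}},$$ where $y_a^*$ is the minimizer of $F_a$. At $y_a^*$, the Hessian of $F_a$ has eigenvalue $\lambda_{\parallel}=\Delta^3/(\delta a^2)$ in the direction of $\widehat b$ and eigenvalue $\lambda_{\perp}=\Delta/\delta$ on $\widehat b^{\perp}$. For $n\ge2$, the Euclidean condition number is $$\operatorname{cond}_2\bigl(\nabla^2F_a(y_a^* )\bigr)=\frac{a^2}{\Delta^2}=\frac{a^2}{a^2-\beta^2}.$$ With $a_\tau=\beta+\tau$, $\tau\downarrow0$ (and $n\ge2$), $$\operatorname{cond}_2\bigl(\nabla^2F_{a_\tau}(y_{a_\tau}^* )\bigr)\sim\frac{\beta}{2\tau}.$$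
   Context: $\|\cdot\|$ is the Euclidean norm, $H^{-1/2}$ is the inverse of the symmetric positive-definite square root of $H$, and $\operatorname{cond}_2$ of a symmetric positive definite matrix is the ratio of its largest to smallest eigenvalue. $A\sim B$ means $A/B\to1$ as $\tau\downarrow0$. *)

(* Defs.v *)
From HB Require Import structures.
From mathcomp Require Import all_boot all_order all_algebra.
From mathcomp Require Import all_classical all_reals all_analysis.

Set Implicit Arguments.
Unset Strict Implicit.
Unset Printing Implicit Defensive.

Import Order.TTheory GRing.Theory Num.Theory.
Import numFieldNormedType.Exports.

Local Open Scope classical_set_scope.
Local Open Scope ring_scope.

Definition dotcv (R : realType) (n : nat) (u v : 'cV[R]_n) : R :=
  (u^T *m v) 0 0.

(* Not the library norm `|v|, which on matrices is the maximum norm. *)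
Definition enorm (R : realType) (n : nat) (v : 'cV[R]_n) : R :=
  Num.sqrt (\sum_(i < n) v i 0 ^+ 2).

Definition spdmx (R : realType) (n : nat) (A : 'M[R]_n) : Prop :=
  A \is symmetricmx /\ forall x : 'cV[R]_n, x != 0 -> 0 < dotcv x (A *m x).

(* For A symmetric positive definite such an S exists and is unique, so the
   choice made by xget (and its default 0) is immaterial there. *)
Definition sqrtmx (R : realType) (n : nat) (A : 'M[R]_n) : 'M[R]_n :=
  xget 0 [set S | spdmx S /\ S *m S = A].

Definition gradient (R : realType) (n : nat) (f : 'cV[R]_n -> R)
    (x : 'cV[R]_n) : 'cV[R]_n :=
  \col_i 'D_(delta_mx i 0) f x.

Definition hessian (R : realType) (n : nat) (f : 'cV[R]_n -> R)
    (x : 'cV[R]_n) : 'M[R]_n :=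
  \matrix_(i, j) 'D_(delta_mx i 0) (fun z => gradient f z j 0) x.

(* 'D_v is total, with a default value where the derivative does not exist;
   this predicate guarantees that gradient and hessian are the genuine ones. *)
Definition twice_differentiable (R : realType) (n : nat) (f : 'cV[R]_n -> R)
    (x : 'cV[R]_n) : Prop :=
  (\forall z \near x, differentiable f z) /\ differentiable (gradient f) x.

(* For symmetric A and n > 0 the set of eigenvalues is finite and nonempty, so
   the supremum and infimum are the largest and the smallest eigenvalue. *)
Definition max_eigenvalue (R : realType) (n : nat) (A : 'M[R]_n) : R :=
  sup [set l | eigenvalue A l].

Definition min_eigenvalue (R : realType) (n : nat) (A : 'M[R]_n) : R :=
  inf [set l | eigenvalue A l].

Definition cond2 (R : realType) (n : nat) (A : 'M[R]_n) : R :=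
  max_eigenvalue A / min_eigenvalue A.

Definition Fobj (R : realType) (n : nat) (delta : R) (c : 'cV[R]_n) (a : R)
    (y : 'cV[R]_n) : R :=
  a * Num.sqrt (delta ^+ 2 + enorm y ^+ 2) + dotcv c y.

(* Main.v *)
Require Import Defs.
From HB Require Import structures.
From mathcomp Require Import all_boot all_order all_algebra.
From mathcomp Require Import all_classical all_reals all_analysis.
From mathcomp Require Import complex.
From mathcomp Require Import ring lra.

(* Write s(y) = sqrt(delta^2 + |y|^2) and c for the vector b-hat.  The gradient
   of F_a is (a/s) y + c and its Hessian is (a/s) I - (a/s^3) y y^T.  At y_a^*
   one has s = delta a / Delta, so the Hessian is the rank-one update
   (Delta/delta) I - (Delta/(delta a^2)) c c^T, whose spectrum is read off.
   The Hessian formula does not need |c| = beta; that equality requires the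
   square root of H, obtained as a polynomial in H: a real symmetric matrix is
   annihilated by every polynomial vanishing on its real spectrum, by the
   spectral theorem over R[i]. *)

Import Order.TTheory GRing.Theory Num.Theory.
Import numFieldNormedType.Exports.

Local Open Scope classical_set_scope.
Local Open Scope ring_scope.

(** * The Euclidean inner product on column vectors *)

Section DotProduct.
Context {R : realType} {n : nat}.
Implicit Types (u v w : 'cV[R]_n) (k : R).

Lemma dotcvE u v : dotcv u v = \sum_i u i 0 * v i 0.
Proof. by rewrite /dotcv mxE; apply: eq_bigr => i _; rewrite mxE. Qed.

Lemma dotcvC u v : dotcv u v = dotcv v u.
Proof. by rewrite !dotcvE; apply: eq_bigr => i _; rewrite mulrC. Qed.

Lemma dotcvDr u v w : dotcv u (v + w) = dotcv u v + dotcv u w.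
Proof. by rewrite /dotcv mulmxDr mxE. Qed.

Lemma dotcvNr u v : dotcv u (- v) = - dotcv u v.
Proof. by rewrite /dotcv mulmxN mxE. Qed.

Lemma dotcvBr u v w : dotcv u (v - w) = dotcv u v - dotcv u w.
Proof. by rewrite dotcvDr dotcvNr. Qed.

Lemma dotcvZr k u v : dotcv u (k *: v) = k * dotcv u v.
Proof. by rewrite /dotcv -scalemxAr mxE. Qed.

Lemma dotcvDl u v w : dotcv (u + v) w = dotcv u w + dotcv v w.
Proof. by rewrite dotcvC dotcvDr !(dotcvC w). Qed.

Lemma dotcvNl u v : dotcv (- u) v = - dotcv u v.
Proof. by rewrite dotcvC dotcvNr dotcvC. Qed.

Lemma dotcvZl k u v : dotcv (k *: u) v = k * dotcv u v.
Proof. by rewrite dotcvC dotcvZr dotcvC. Qed.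

Lemma dotcv_delta i u : dotcv (delta_mx i 0) u = u i 0.
Proof.
rewrite dotcvE (bigD1 i) //= mxE !eqxx mul1r big1 ?addr0 // => j /negbTE ji.
by rewrite mxE ji mul0r.
Qed.

Lemma dotcv_ge0 u : 0 <= dotcv u u.
Proof. by rewrite dotcvE sumr_ge0 // => i _; rewrite -expr2 sqr_ge0. Qed.

Lemma dotcv_eq0 u : (dotcv u u == 0) = (u == 0).
Proof.
apply/idP/eqP => [|->]; last by rewrite /dotcv mulmx0 mxE.
rewrite dotcvE psumr_eq0 => [/allP u0|i _]; last by rewrite -expr2 sqr_ge0.
apply/colP => i; have := u0 i (mem_index_enum i).
by rewrite mulf_eq0 orbb mxE => /eqP.
Qed.

Lemma dotcv_gt0 u : (0 < dotcv u u) = (u != 0).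
Proof. by rewrite lt0r dotcv_ge0 dotcv_eq0 andbT. Qed.

Lemma enormE u : enorm u = Num.sqrt (dotcv u u).
Proof. by rewrite /enorm dotcvE. Qed.

Lemma sqr_enorm u : enorm u ^+ 2 = dotcv u u.
Proof. by rewrite enormE sqr_sqrtr ?dotcv_ge0. Qed.

(** The squared length of [(u.u) v - (u.v) u] equals [u.u] times the defect
    [(u.u)(v.v) - (u.v)^2]. *)
Lemma cauchy_schwarz_dotcv u v : dotcv u v ^+ 2 <= dotcv u u * dotcv v v.
Proof.
have [->|u0] := eqVneq u 0.
  by rewrite {1}/dotcv trmx0 mul0mx mxE expr0n mulr_ge0 ?dotcv_ge0.
have uu0 : 0 < dotcv u u by rewrite dotcv_gt0.
rewrite -subr_ge0 -(pmulr_rge0 _ uu0).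
have := dotcv_ge0 (dotcv u u *: v - dotcv u v *: u).
rewrite dotcvBr !(dotcvZr, dotcvDl, dotcvNl, dotcvZl) (dotcvC v u).
by congr (0 <= _); ring.
Qed.

Lemma mul_outer_cv u v : u *m u^T *m v = dotcv u v *: u.
Proof. by rewrite -mulmxA [u^T *m v]mx11_scalar mul_mx_scalar. Qed.

Lemma dotcv_trmx (A : 'M[R]_n) u v : dotcv u (A *m v) = dotcv (A^T *m u) v.
Proof. by rewrite /dotcv trmx_mul trmxK mulmxA. Qed.

Lemma symmetricmxP (A : 'M[R]_n) : reflect (A^T = A) (A \is symmetricmx).
Proof.
by apply: (iffP (is_hermitianmxP _ _ _)); rewrite expr0 scale1r map_mx_id.
Qed.

End DotProduct.

(** * Interpolation and polynomials in a matrix *)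

(** Newton's scheme: a new node [a] is met by adding a multiple of [m], which vanishes at all
    earlier nodes. *)
Lemma poly_interpolation {F : fieldType} (g : F -> F) (s : seq F) :
  exists p : {poly F}, forall x, x \in s -> p.[x] = g x.
Proof.
elim: s => [|a s [p ps]]; first by exists 0.
have [sa|sa] := boolP (a \in s).
  by exists p => x; rewrite inE => /predU1P[->|]; exact: ps.
pose m : {poly F} := \prod_(y <- s) ('X - y%:P).
have ma0 : m.[a] != 0 by apply: contra sa => ma0; rewrite -root_prod_XsubC.
exists (p + ((g a - p.[a]) / m.[a]) *: m) => x.
rewrite inE !hornerE => /predU1P[->|xs]; first by rewrite divfK // addrC subrK.
have /eqP -> : root m x by rewrite root_prod_XsubC.
by rewrite mulr0 addr0 ps.
Qed.

(** Makes polynomials in a symmetric matrix symmetric. Transposition reverses products, but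
    polynomials in one matrix commute. *)
Lemma trmx_horner_mx {K : comNzRingType} n (A : 'M[K]_n.+1) (p : {poly K}) :
  (horner_mx A p)^T = horner_mx A^T p.
Proof.
elim/poly_ind: p => [|p c IH]; first by rewrite !rmorph0 trmx0.
rewrite !rmorphD !rmorphM /= !horner_mx_X !horner_mx_C linearD /= trmx_mul IH.
have := comm_horner_mx2 A^T p 'X; rewrite horner_mx_X tr_scalar_mx => ->.
by rewrite mulmxE.
Qed.

(** * Positive definite matrices and their square roots *)

Section SquareRoot.
Context {R : realType}.

Lemma spdmx_eigenvalue_gt0 n (A : 'M[R]_n) r :
  spdmx A -> eigenvalue A r -> 0 < r.
Proof.
move=> [/symmetricmxP As Ap] /eigenvalueP[v vA v0].
have w0 : v^T != 0 by rewrite -trmx0 (inj_eq trmx_inj).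
have := Ap _ w0; rewrite -{1}As -trmx_mul vA linearZ /= dotcvZr.
by rewrite pmulr_lgt0 // dotcv_gt0.
Qed.

Lemma spdmx_unitmx n (A : 'M[R]_n) : spdmx A -> A \in unitmx.
Proof.
move=> Aspd; rewrite -row_free_unit -kermx_eq0; apply/negPn/negP => k0.
suff : (0 : R) < 0 by rewrite ltxx.
apply: (@spdmx_eigenvalue_gt0 n A) => //.
by rewrite /eigenvalue /eigenspace -scalemx1 scale0r subr0.
Qed.

(** Over [R[i]] the matrix is Hermitian, hence unitarily diagonalizable with real diagonal [d]. The
    list [s] holds these diagonal entries as reals, and [p(A)] is conjugate to the diagonal matrix
    of the values of [p] on [s]. *)
Lemma symmetricmx_annihilated n (A : 'M[R]_n.+1) : A \is symmetricmx ->
  exists s : seq R, all (eigenvalue A) s /\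
    forall p : {poly R}, (forall x, x \in s -> p.[x] = 0) -> horner_mx A p = 0.
Proof.
move=> /symmetricmxP As.
pose toC := real_complex R : R -> R[i].
pose AC : 'M[R[i]]_n.+1 := map_mx toC A.
have ACh : AC \is hermsymmx.
  apply: realsym_hermsym.
    by apply/is_hermitianmxP; rewrite expr0 scale1r map_mx_id // map_trmx As.
  by apply/mxOverP => i j; rewrite mxE; apply/complex_realP; exists (A i j).
have /orthomx_spectralP := hermitian_normalmx ACh.
set U := spectralmx AC; set d := spectral_diag AC => ACE.
have Uu : U \in unitmx := spectral_unit _.
have dr i : exists r, d 0 i = toC r.
  have /mxOverP /(_ 0 i) := hermitian_spectral_diag_real ACh.
  by move/complex_realP.
pose r i := sval (cid (dr i)).
have rE i : d 0 i = toC (r i) by rewrite /r; case: cid.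
exists [seq r i | i <- enum 'I_n.+1]; split.
  apply/allP => _ /mapP[i _ ->]; rewrite eigenvalue_root_char.
  (* No real eigenvector is built: being a root of the characteristic polynomial descends from
     [R[i]] to [R], and over [R[i]] row [i] of [U] is an eigenvector. *)
  have -> : root (char_poly A) (r i) = root (char_poly AC) (d 0 i).
    by rewrite rE -map_char_poly fmorph_root.
  rewrite -eigenvalue_root_char.
  apply/eigenvalueP; exists (row i U).
    rewrite -row_mul {1}ACE !mulmxA mulmxV // mul1mx row_mul row_diag_mx.
    by rewrite -scalemxAl -rowE.
  rewrite rowE; apply: contraTneq isT => /(congr1 (mulmx^~ (invmx U))).
  rewrite mulmxK // mul0mx => /matrixP/(_ 0 i)/eqP.
  by rewrite !mxE !eqxx oner_eq0.
move=> p p0; apply/eqP; rewrite -(map_mx_eq0 (real_complex R)) map_horner_mx.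
rewrite -/AC ACE horner_mx_uconjC // horner_mx_diag.
rewrite (_ : map_mx _ d = 0) ?linear0 ?mulmx0 ?mul0mx //.
apply/rowP => i; rewrite !mxE rE horner_map p0 ?rmorph0 //.
by apply: map_f; rewrite mem_enum.
Qed.

(* For q interpolating the fourth root on the spectrum, q(A)^2 is a symmetric
   square root of A that is visibly positive. *)
Lemma sqrtmx_exists n (A : 'M[R]_n.+1) : spdmx A ->
  exists S, spdmx S /\ S *m S = A.
Proof.
move=> Aspd; have [Asym Apos] := Aspd.
have [s [/allP seig ann]] := symmetricmx_annihilated _ _ Asym.
have [q qs] := poly_interpolation (fun x : R => Num.sqrt (Num.sqrt x)) s.
pose Q := horner_mx A q.
(* The difference of both sides is [q^4 - X] evaluated at [A]; this polynomial vanishes on [s],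
   where [q] is the fourth root of a positive eigenvalue. *)
have QQE : Q *m Q *m (Q *m Q) = A.
  apply/eqP; rewrite -subr_eq0 !mulmxE /Q -!rmorphM /= -[X in _ - X]horner_mx_X.
  rewrite -rmorphB /= ann // => x xs; rewrite !hornerE qs //= -mulrA -!expr2.
  have x0 := ltW (spdmx_eigenvalue_gt0 _ _ _ Aspd (seig _ xs)).
  by rewrite sqr_sqrtr ?sqrtr_ge0 // sqr_sqrtr // subrr.
have QT : Q^T = Q by rewrite trmx_horner_mx; move/symmetricmxP: Asym => ->.
exists (Q *m Q); split=> //; split.
  by apply/symmetricmxP; rewrite trmx_mul QT.
move=> x x0; rewrite -mulmxA dotcv_trmx QT dotcv_gt0.
(* A vector killed by [Q] would be killed by [A = Q^4]. *)
apply: contraTneq (Apos _ x0) => Qx0.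
by rewrite -QQE -!mulmxA Qx0 !mulmx0 /dotcv mulmx0 mxE ltxx.
Qed.

Lemma sqrtmxP n (A : 'M[R]_n) : (0 < n)%N -> spdmx A ->
  spdmx (sqrtmx A) /\ sqrtmx A *m sqrtmx A = A.
Proof.
case: n A => // n A _ /sqrtmx_exists.
exact: (@xgetPex _ 0 [set S | spdmx S /\ S *m S = A]).
Qed.

(** By symmetry of the root [S], the squared length of [S^-1 b] is [b.(S^-1 S^-1 b)], and
    [S^-1 S^-1 = A^-1]. *)
Lemma enorm_invmx_sqrtmx n (A : 'M[R]_n) (b : 'cV[R]_n) : (0 < n)%N ->
  spdmx A -> enorm (invmx (sqrtmx A) *m b) = Num.sqrt (dotcv b (invmx A *m b)).
Proof.
move=> n0 /(sqrtmxP _ _ n0)[Sspd SS]; set S := sqrtmx A in Sspd SS *.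
have Su := spdmx_unitmx _ _ Sspd; have /symmetricmxP ST := Sspd.1.
rewrite enormE; congr Num.sqrt; rewrite -[in RHS]SS.
have -> : invmx (S *m S) = invmx S *m invmx S.
  apply: (canRL (mulmxK Su)); apply: (can_inj (mulmxK Su)).
  by rewrite -mulmxA !mulVmx // unitmx_mul Su.
by rewrite -[in RHS]mulmxA [RHS]dotcv_trmx trmx_inv ST.
Qed.

End SquareRoot.

(** * Spectrum and condition number of a scalar matrix minus a rank-one term *)

Section Eigenvalues.
Context {R : realType} {n : nat}.
Implicit Types (c : 'cV[R]_n) (al ga : R).

Lemma rank1_updateE al ga c (v : 'cV[R]_n) :
  (al%:M - ga *: (c *m c^T)) *m v = al *: v - (ga * dotcv c v) *: c.
Proof. by rewrite mulmxBl mul_scalar_mx -scalemxAl mul_outer_cv scalerA. Qed.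

Lemma symmetric_rank1_update al ga c :
  (al%:M - ga *: (c *m c^T))^T = al%:M - ga *: (c *m c^T).
Proof. by rewrite linearB linearZ /= tr_scalar_mx trmx_mul trmxK. Qed.

(** Cauchy-Schwarz bounds the subtracted form [ga (c.x)^2] by [ga (c.c)(x.x)]. *)
Lemma spdmx_rank1_update al ga c : 0 <= ga -> ga * dotcv c c < al ->
  spdmx (al%:M - ga *: (c *m c^T)).
Proof.
move=> ga0 gaal; split; first exact/symmetricmxP/symmetric_rank1_update.
move=> x x0; rewrite rank1_updateE dotcvBr !dotcvZr (dotcvC x c) subr_gt0.
apply: (@le_lt_trans _ _ (ga * (dotcv c c * dotcv x x))).
  by rewrite -mulrA ler_wpM2l // -expr2 cauchy_schwarz_dotcv.
by rewrite mulrA ltr_pM2r // dotcv_gt0.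
Qed.

Lemma orthogonal_cv_exists c : (1 < n)%N ->
  exists2 v : 'cV[R]_n, v != 0 & dotcv c v = 0.
Proof.
move=> n1; have : kermx c != 0.
  rewrite -mxrank_eq0 mxrank_ker -lt0n subn_gt0.
  by apply: leq_trans n1; rewrite ltnS rank_leq_col.
move=> /rowV0Pn[v /sub_kermxP vc v0]; exists v^T.
  by rewrite -trmx0 (inj_eq trmx_inj).
by rewrite dotcvC /dotcv trmxK vc mxE.
Qed.

(** Pairing [M v = l v] with [c] gives [(al - ga (c.c) - l)(c.v) = 0]; if [c.v = 0], then
    [M v = al v]. Conversely, [c] and a nonzero vector orthogonal to it are eigenvectors. *)
Lemma eigenvalue_rank1_update al ga c l : (1 < n)%N -> c != 0 ->
  eigenvalue (al%:M - ga *: (c *m c^T)) l <->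
  l = al - ga * dotcv c c \/ l = al.
Proof.
move=> n1 c0; set M := _ - _.
have MT : M^T = M := symmetric_rank1_update _ _ _.
(* [eigenvalue] refers to row eigenvectors; symmetry of [M] gives access to columns. *)
have eigM (v : 'cV[R]_n) k : v != 0 -> M *m v = k *: v -> eigenvalue M k.
  move=> v0 Mv; apply/eigenvalueP; exists v^T.
    by rewrite -MT -trmx_mul Mv linearZ.
  by rewrite -trmx0 (inj_eq trmx_inj).
split.
  move=> /eigenvalueP[w wM w0].
  have v0 : w^T != 0 by rewrite -trmx0 (inj_eq trmx_inj).
  have : M *m w^T = l *: w^T by rewrite -MT -trmx_mul wM linearZ.
  rewrite /M rank1_updateE; move: (w^T) v0 => v v0 Mv.
  have cv : (al - ga * dotcv c c - l) * dotcv c v = 0.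
    have := congr1 (dotcv c) Mv; rewrite dotcvBr !dotcvZr => cMv.
    by rewrite mulrBl -cMv; ring.
  move/eqP: cv; rewrite mulf_eq0 subr_eq0 => /orP[/eqP <-|/eqP cv0].
    by left.
  right; apply/eqP; move: Mv; rewrite cv0 mulr0 scale0r subr0 => /eqP.
  by rewrite -subr_eq0 -scalerBl scaler_eq0 (negbTE v0) orbF subr_eq0 eq_sym.
case=> ->.
  by apply: (eigM c) => //; rewrite rank1_updateE scalerBl.
have [v v0 cv] := orthogonal_cv_exists c n1.
by apply: (eigM v) => //; rewrite rank1_updateE cv mulr0 scale0r subr0.
Qed.

Lemma cond2_rank1_update al ga c : (1 < n)%N -> c != 0 -> 0 <= ga ->
  cond2 (al%:M - ga *: (c *m c^T)) = al / (al - ga * dotcv c c).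
Proof.
move=> n1 c0 ga0; rewrite /cond2 /max_eigenvalue /min_eigenvalue.
have -> : [set l | eigenvalue (al%:M - ga *: (c *m c^T)) l] =
    [set al - ga * dotcv c c] `|` [set al].
  by apply/seteqP; split=> l /= /(eigenvalue_rank1_update _ _ _ _ n1 c0).
have le_al : al - ga * dotcv c c <= al.
  by rewrite gerBl mulr_ge0 // dotcv_ge0.
(* The first singleton lies below the second, so the supremum is read off the second and the infimum
   off the first. *)
rewrite sup_setU ?inf_setU ?sup1 ?inf1 //.
- by move=> ? ? -> ->.
- by move=> ? ? -> ->.
Qed.

End Eigenvalues.

(** * Derivatives of linear forms and of the squared norm *)

Section DotProductCalculus.
Context {R : realType} {n : nat}.
Implicit Types c y v : 'cV[R]_n.

Lemma is_derive_coord i y v : is_derive y v (fun z : 'cV[R]_n => z i 0) (v i 0).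
Proof.
have dy : derivable (@id 'cV[R]_n) y v by exact: derivable_id.
apply: DeriveDef; first exact: (derivable_mxP _ _ _).1.
by have := derive_id y v; rewrite derive_mx // => /matrixP/(_ i 0); rewrite mxE.
Qed.

Lemma is_derive_dotcvl c y v : is_derive y v (dotcv c) (dotcv c v).
Proof.
have cE : dotcv c = \sum_(i < n) (c i 0 *: fun z : 'cV[R]_n => z i 0).
  by apply/funext => z; rewrite dotcvE fct_sumE.
rewrite dotcvE cE; apply: is_derive_sum => i; apply: is_deriveZ.
exact: is_derive_coord.
Qed.

Lemma is_derive_dotcv y v :
  is_derive y v (fun z : 'cV[R]_n => dotcv z z) (2 * dotcv y v).
Proof.
have -> : (fun z : 'cV[R]_n => dotcv z z) =
    \sum_(i < n) ((fun z : 'cV[R]_n => z i 0) ^+ 2).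
  by apply/funext => z; rewrite dotcvE fct_sumE.
rewrite dotcvE mulr_sumr; apply: is_derive_sum => i.
have := @is_deriveX _ _ _ 2 y v _ (is_derive_coord i y v).
by rewrite expr1 mulrA.
Qed.

Lemma differentiable_dotcv y : differentiable (fun z : 'cV[R]_n => dotcv z z) y.
Proof.
have -> : (fun z : 'cV[R]_n => dotcv z z) =
    \sum_(i < n) ((fun z : 'cV[R]_n => z i 0) ^+ 2).
  by apply/funext => z; rewrite dotcvE fct_sumE.
apply: differentiable_sum => i; apply: differentiableX.
exact: differentiable_coord.
Qed.

End DotProductCalculus.

(** * Gradient and Hessian of the objective *)

Section Objective.
Context {R : realType} {n : nat}.
Context (delta : R) (delta_gt0 : 0 < delta).
Implicit Types (c y v : 'cV[R]_n) (a : R).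

Let s y : R := Num.sqrt (delta ^+ 2 + enorm y ^+ 2).

Let s_gt0 y : 0 < s y.
Proof. by rewrite sqrtr_gt0 ltr_wpDr ?sqr_ge0 // exprn_gt0. Qed.

Let sqr_s y : s y ^+ 2 = delta ^+ 2 + dotcv y y.
Proof. by rewrite sqr_sqrtr -?sqr_enorm // addr_ge0 ?sqr_ge0. Qed.

Let differentiable_s y : differentiable s y.
Proof.
have -> : s = Num.sqrt \o (cst (delta ^+ 2) + fun z => dotcv z z).
  by apply/funext => z /=; rewrite /s sqr_enorm.
apply: differentiable_comp.
  apply: differentiableD; first exact: differentiable_cst.
  exact: differentiable_dotcv.
apply/derivable1_diffP; apply: ex_derive; apply: is_derive1_sqrt.
by rewrite -[ltRHS]/(delta ^+ 2 + dotcv y y) -sqr_s exprn_gt0.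
Qed.

(** Differentiating [s * s = delta^2 + z.z] by the product rule gives [2 s s' = 2 (y.v)]. *)
Let is_derive_s y v : is_derive y v s (dotcv y v / s y).
Proof.
have ds : derivable s y v by exact: diff_derivable.
apply: DeriveDef => //.
have sE : s * s = cst (delta ^+ 2) + (fun z : 'cV[R]_n => dotcv z z).
  by apply/funext => z; rewrite -[RHS]/(delta ^+ 2 + dotcv z z) -sqr_s.
have s2 : is_derive y v (s * s) (2 * dotcv y v).
  by rewrite sE -[2 * _]add0r; apply: is_deriveD; exact: is_derive_dotcv.
have := deriveM ds ds; rewrite derive_val => /= E.
apply: (mulfI (lt0r_neq0 (s_gt0 y))); rewrite mulrCA divff ?gt_eqF // mulr1.
by move: E; rewrite -[LHS]/(2 * dotcv y v) /GRing.scale /=; lra.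
Qed.

Lemma is_derive_Fobj a c y v :
  is_derive y v (Fobj delta c a) (a * (dotcv y v / s y) + dotcv c v).
Proof.
apply: (@is_deriveD _ _ _ (a *: s) (dotcv c)); first exact: is_deriveZ.
exact: is_derive_dotcvl.
Qed.

Lemma differentiable_Fobj a c y : differentiable (Fobj delta c a) y.
Proof.
apply: (@differentiableD _ _ _ (a *: s) (dotcv c)); first exact: differentiableZ.
have -> : dotcv c = \sum_(i < n) (c i 0 *: fun z : 'cV[R]_n => z i 0).
  by apply/funext => z; rewrite dotcvE fct_sumE.
apply: differentiable_sum => i; apply: differentiableZ.
exact: differentiable_coord.
Qed.

Lemma gradient_Fobj a c :
  gradient (Fobj delta c a) = fun y => (a / s y) *: y + c.
Proof.
apply/funext => y; apply/colP => i; rewrite !mxE.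
rewrite (derive_val (is_derive := is_derive_Fobj a c y _)).
by rewrite !(dotcvC _ (delta_mx i 0)) !dotcv_delta mulrA mulrAC.
Qed.

Lemma twice_differentiable_Fobj a c y : twice_differentiable (Fobj delta c a) y.
Proof.
split; first by near=> z; exact: differentiable_Fobj.
rewrite gradient_Fobj; apply: differentiableD; last exact: differentiable_cst.
(* Expansion in the standard basis reduces differentiability of the vector field to that of its
   scalar coefficients. *)
have -> : (fun z : 'cV[R]_n => (a / s z) *: z) =
    \sum_(i < n) (fun z => (a / s z * z i 0) *: (delta_mx i 0 : 'cV[R]_n)).
  apply/funext => z; rewrite fct_sumE; apply/colP => k.
  rewrite summxE (bigD1 k) //= !mxE !eqxx mulr1 big1 ?addr0 // => i /negbTE ik.
  by rewrite !mxE eq_sym ik mulr0.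
apply: differentiable_sum => i; apply: differentiableZl.
apply: differentiableM; last exact: differentiable_coord.
apply: (@differentiableZ _ _ _ (fun z => (s z)^-1)).
by apply: differentiableV => //; rewrite gt_eqF.
Unshelve. all: by end_near. Qed.

Lemma hessian_Fobj a c y :
  hessian (Fobj delta c a) y = (a / s y)%:M - (a / s y ^+ 3) *: (y *m y^T).
Proof.
apply/matrixP => i j; rewrite mxE gradient_Fobj.
have -> : (fun z : 'cV[R]_n => ((a / s z) *: z + c) j 0) =
    (a *: (fun z => (s z)^-1)) * (fun z => z j 0) + cst (c j 0).
  by apply/funext => z; rewrite !mxE.
(* This factor, [-y_i / s^3], produces the rank-one term; differentiating the coordinate produces
   the scalar matrix. *)
have dV : is_derive y (delta_mx i 0) (fun z => (s z)^-1)
    (- (s y) ^- 2 * (y i 0 / s y)).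
  have ds := is_derive_s y (delta_mx i 0).
  have s0 : s y != 0 by rewrite gt_eqF.
  apply: DeriveDef; first exact: derivableV.
  by rewrite deriveV // derive_val dotcvC dotcv_delta.
have dc := is_derive_coord j y (delta_mx i 0).
rewrite deriveD //.
rewrite derive_cst addr0 deriveM // deriveZ // !derive_val.
rewrite !mxE big_ord1 !mxE !ord1 eqxx andbT (eq_sym j) -mulr_natr.
rewrite -[(a *: _) y]/(a / s y) /GRing.scale /=.
by field; rewrite gt_eqF.
Qed.

(** * The minimizer and the Hessian at it, with [c] in the role of b-hat *)

Section Minimizer.
Context (c : 'cV[R]_n) (a : R) (a_gt : enorm c < a).

Let D : R := Num.sqrt (a ^+ 2 - enorm c ^+ 2).
Let ystar : 'cV[R]_n := - ((delta / D) *: c).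

Let a_gt0 : 0 < a.
Proof. by apply: le_lt_trans a_gt; rewrite enormE sqrtr_ge0. Qed.

Let sqr_gap_gt0 : 0 < a ^+ 2 - enorm c ^+ 2.
Proof.
by rewrite subr_gt0 ltr_sqr // nnegrE ?(ltW a_gt0) // enormE sqrtr_ge0.
Qed.

Let D_gt0 : 0 < D. Proof. by rewrite sqrtr_gt0. Qed.

Let sqr_D : D ^+ 2 = a ^+ 2 - dotcv c c.
Proof. by rewrite sqr_sqrtr ?(ltW sqr_gap_gt0) // sqr_enorm. Qed.

Let dotcE : dotcv c c = a ^+ 2 - D ^+ 2. Proof. by rewrite sqr_D; ring. Qed.

(** Both sides are positive, so squares are compared: [delta^2 + delta^2 (c.c) / D^2 = delta^2 a^2 /
    D^2]. *)
Let s_ystar : s ystar = delta * a / D.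
Proof.
apply/eqP; rewrite -(@eqrXn2 _ 2) ?ltW // ?divr_gt0 ?mulr_gt0 //.
rewrite sqr_s /ystar dotcvNl dotcvNr opprK dotcvZl dotcvZr dotcE.
by apply/eqP; field; rewrite gt_eqF.
Qed.

Let Fobj_ystar : Fobj delta c a ystar = delta * D.
Proof.
rewrite /Fobj -/(s ystar) s_ystar /ystar dotcvNr dotcvZr.
by rewrite dotcE; field; rewrite gt_eqF.
Qed.

(* By Lagrange's identity a^2 s(y)^2 - (delta D - c.y)^2 is the sum of
   |D y + delta c|^2 and the Cauchy-Schwarz defect of c and y. *)
Lemma Fobj_minimum y : y != ystar -> Fobj delta c a ystar < Fobj delta c a y.
Proof.
move=> yy; rewrite Fobj_ystar /Fobj -/(s y) -ltrBlDr.
have as0 : 0 < a * s y by rewrite mulr_gt0.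
(* The goal is now [delta D - c.y < a s(y)]; passing to the absolute value on the left permits
   squaring. *)
apply: (le_lt_trans (ler_norm _)).
rewrite -ltr_sqr ?nnegrE ?normr_ge0 ?(ltW as0) // real_normK ?num_real //.
(* Source of strictness: this vector vanishes only at [ystar]. *)
have w0 : D *: y + delta *: c != 0.
  apply: contra yy; rewrite addr_eq0 => /eqP Dy; apply/eqP.
  rewrite -[y](scalerK (lt0r_neq0 D_gt0)) Dy scalerN scalerA /ystar.
  by rewrite mulrC.
have := dotcv_gt0 (D *: y + delta *: c); rewrite w0.
rewrite dotcvDr !(dotcvDl, dotcvZl, dotcvZr) (dotcvC y c) => w1.
have cs := cauchy_schwarz_dotcv c y.
rewrite exprMn sqr_s.
have -> : a ^+ 2 = D ^+ 2 + dotcv c c by rewrite sqr_D subrK.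
nra.
Qed.

Lemma hessian_ystar : hessian (Fobj delta c a) ystar =
  (D / delta)%:M - (D / (delta * a ^+ 2)) *: (c *m c^T).
Proof.
have yyT : ystar *m ystar^T = (delta / D * (delta / D)) *: (c *m c^T).
  have -> : ystar = (- (delta / D)) *: c by rewrite scaleNr.
  move: (- _) (mulrNN (delta / D) (delta / D)) => k <-.
  by rewrite linearZ /= -scalemxAl -scalemxAr scalerA.
rewrite hessian_Fobj s_ystar yyT scalerA.
by congr (_%:M - _ *: _); field; rewrite !gt_eqF.
Qed.

(** The eigenvalue along [c]: [(D / delta)(1 - c.c / a^2)] with [a^2 - c.c = D^2]. Its positivity
    also gives definiteness. *)
Let gap : D / delta - D / (delta * a ^+ 2) * dotcv c c =
  D ^+ 3 / (delta * a ^+ 2).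
Proof. by rewrite dotcE; field; rewrite !gt_eqF. Qed.

Lemma spdmx_hessian_ystar : spdmx (hessian (Fobj delta c a) ystar).
Proof.
rewrite hessian_ystar; apply: spdmx_rank1_update.
  by rewrite divr_ge0 ?mulr_ge0 ?exprn_ge0 ?ltW.
by rewrite -subr_gt0 gap divr_gt0 ?mulr_gt0 ?exprn_gt0.
Qed.

Lemma hessian_ystar_parallel : hessian (Fobj delta c a) ystar *m c =
  (D ^+ 3 / (delta * a ^+ 2)) *: c.
Proof. by rewrite hessian_ystar rank1_updateE -scalerBl gap. Qed.

Lemma hessian_ystar_orthogonal v : dotcv c v = 0 ->
  hessian (Fobj delta c a) ystar *m v = (D / delta) *: v.
Proof.
by move=> cv; rewrite hessian_ystar rank1_updateE cv mulr0 scale0r subr0.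
Qed.

Lemma cond2_hessian_ystar : (1 < n)%N -> c != 0 ->
  cond2 (hessian (Fobj delta c a) ystar) = a ^+ 2 / D ^+ 2.
Proof.
move=> n1 c0; rewrite hessian_ystar cond2_rank1_update //.
  by rewrite gap; field; rewrite !gt_eqF.
by rewrite divr_ge0 ?mulr_ge0 ?exprn_ge0 ?ltW.
Qed.

End Minimizer.

End Objective.

(** * Asymptotics as [a] decreases to [beta] *)

Lemma cond2_asymptotics {R : realType} (beta : R) (K : R -> R) : 0 < beta ->
  (forall a, beta < a -> K a = a ^+ 2 / (a ^+ 2 - beta ^+ 2)) ->
  K (beta + tau) / (beta / (2 * tau)) @[tau --> 0^'+] --> (1 : R).
Proof.
move=> beta0 KE.
(* The quotient after cancelling [tau], using [(beta + tau)^2 - beta^2 = tau (2 beta + tau)]; it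
   extends continuously to [g 0 = 1]. *)
pose g (tau : R) := 2 * (beta + tau) ^+ 2 / (beta * (2 * beta + tau)).
have g1 : g tau @[tau --> 0^'+] --> (1 : R).
  apply: cvg_at_right_filter.
  have -> : 1 = g 0 by rewrite /g; field; rewrite gt_eqF.
  have cD (k : R) : k + tau @[tau --> (0 : R)] --> k + 0.
    by apply: cvgD; [exact: cvg_cst|exact: cvg_id].
  apply: cvgM.
    by apply: cvgM; [exact: cvg_cst|apply: cvgM; exact: cD].
  apply: cvgV; first by rewrite gt_eqF // mulr_gt0 // addr0 mulr_gt0.
  by apply: cvgM; [exact: cvg_cst|exact: cD].
(* The quotient agrees with [g] for [tau > 0], which suffices for a right limit. *)
apply: cvg_trans g1; apply: near_eq_cvg; near=> tau.
have tau0 : 0 < tau by near: tau; exact: nbhs_right_gt.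
have bt0 : 0 < 2 * beta + tau by rewrite addr_gt0 ?mulr_gt0.
rewrite KE ?ltrDl // /g.
have -> : (beta + tau) ^+ 2 - beta ^+ 2 = tau * (2 * beta + tau) by ring.
by field; rewrite !gt_eqF.
Unshelve. all: by end_near. Qed.

(** * Specialization to [H] and [b] *)

Theorem proposition8p2 (R : realType) (n : nat) (H : 'M[R]_n) (delta : R)
    (b : 'cV[R]_n) :
  (1 <= n)%N -> spdmx H -> 0 < delta -> b != 0 ->
  let beta : R := Num.sqrt (dotcv b (invmx H *m b)) in
  let bhat : 'cV[R]_n := invmx (sqrtmx H) *m b in
  let F : R -> 'cV[R]_n -> R := Fobj delta bhat in
  let Delta : R -> R := fun a => Num.sqrt (a ^+ 2 - beta ^+ 2) in
  let ystar : R -> 'cV[R]_n := fun a =>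
    - ((delta / Num.sqrt (a ^+ 2 - beta ^+ 2)) *: bhat) in
  [/\ 0 < beta,
      enorm bhat = beta,
      forall a : R, beta < a ->
        [/\ forall y : 'cV[R]_n, y != ystar a -> F a (ystar a) < F a y,
            twice_differentiable (F a) (ystar a) /\
              spdmx (hessian (F a) (ystar a)),
            hessian (F a) (ystar a) *m bhat
              = (Delta a ^+ 3 / (delta * a ^+ 2)) *: bhat,
            forall v : 'cV[R]_n, dotcv bhat v = 0 ->
              hessian (F a) (ystar a) *m v = (Delta a / delta) *: v
          & (2 <= n)%N ->
              cond2 (hessian (F a) (ystar a)) = a ^+ 2 / Delta a ^+ 2 /\
              a ^+ 2 / Delta a ^+ 2 = a ^+ 2 / (a ^+ 2 - beta ^+ 2)]
    & (2 <= n)%N ->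
        cond2 (hessian (F (beta + tau)) (ystar (beta + tau)))
          / (beta / (2 * tau)) @[tau --> 0^'+] --> (1 : R)].
Proof.
move=> n1 Hspd delta0 b0 beta bhat F Delta ystar.
have nbhat : enorm bhat = beta := enorm_invmx_sqrtmx _ _ _ n1 Hspd.
have bhat0 : bhat != 0.
  have Su := spdmx_unitmx _ _ (sqrtmxP _ _ n1 Hspd).1.
  by apply: contra b0 => /eqP /(canRL (mulKVmx Su)); rewrite mulmx0 => ->.
have beta0 : 0 < beta by rewrite -nbhat enormE sqrtr_gt0 dotcv_gt0.
have sqr_Delta a : beta < a -> Delta a ^+ 2 = a ^+ 2 - beta ^+ 2.
  move=> ba; rewrite sqr_sqrtr // subr_ge0 ler_sqr ?nnegrE ltW //.
  exact: lt_trans ba.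
have condE a : (2 <= n)%N -> beta < a ->
    cond2 (hessian (F a) (ystar a)) = a ^+ 2 / Delta a ^+ 2.
  (* Replacing [beta] by the norm of [bhat] puts the goal in the form treated for a general vector
     [c]. *)
  move=> n2; rewrite /ystar /Delta -nbhat => ba.
  exact: cond2_hessian_ystar.
split=> // [a ba|n2]; last first.
  pose K a := cond2 (hessian (F a) (ystar a)).
  apply: (@cond2_asymptotics _ _ K) => //.
  by move=> a ba; rewrite /K condE // sqr_Delta.
split.
- by rewrite /ystar -nbhat in ba *; exact: Fobj_minimum.
- split; first exact: twice_differentiable_Fobj.
  by rewrite /ystar -nbhat in ba *; exact: spdmx_hessian_ystar.
- by rewrite /ystar /Delta -nbhat in ba *; exact: hessian_ystar_parallel.
- by rewrite /ystar /Delta -nbhat in ba *; exact: hessian_ystar_orthogonal.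
- by move=> n2; rewrite condE // sqr_Delta.
Qed.
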